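(* Let $(\mathcal{A}',\mathcal{A},\mathcal{A}'',i^*,i_*,i^!,j_!,j^*,j_* )$ be a recollement of abelian categories satisfying condition (P). Assume that $(\mathcal{U}',\mathcal{V}')$ and $(\mathcal{U}'',\mathcal{V}'')$ are cotorsion pairs in $\mathcal{A}'$ and $\mathcal{A}''$, respectively. If $(\mathbb{L}_1j_!)(\mathcal{U}'')=0$ and $(\mathbb{R}_1j_* )(\mathcal{V}'')=0$, then $$({}^{\perp}\mathcal{N}^{\mathcal{V}'}_{\mathcal{V}''},\ \mathcal{N}^{\mathcal{V}'}_{\mathcal{V}''})=(\mathcal{M}^{\mathcal{U}'}_{\mathcal{U}''},\ (\mathcal{M}^{\mathcal{U}'}_{\mathcal{U}''})^{\perp}).$$
   Context: All abelian categories are assumed to have enough projective and enough injective objects. All classes of objects (subcategories) are full and closed under isomorphisms. A recollement $(\mathcal{A}',\mathcal{A},\mathcal{A}'',i^*,i_*,i^!,j_!,j^*,j_* )$ of abelian categories consists of functors $i_*:\mathcal{A}'\to\mathcal{A}$, $i^*,i^!:\mathcal{A}\to\mathcal{A}'$, $j^*:\mathcal{A}\to\mathcal{A}''$, $j_!,j_*:\mathcal{A}''\to\mathcal{A}$ such that $(i^*,i_* )$, $(i_*,i^!)$, $(j_!,j^* )$, $(j^*,j_* )$ are adjoint pairs (left adjoint written first), $i_*,j_!,j_*$ are fully faithful, and $\operatorname{Ker} j^*=\operatorname{Im} i_*$. It satisfies condition (P) if $\varepsilon_P: j_!j^*P\to P$ is a monomorphism for every projective object $P$ of $\mathcal{A}$,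 where $\varepsilon:j_!j^*\to 1_{\mathcal{A}}$ is the counit of $(j_!,j^* )$. $\mathbb{L}_1F$ denotes the first left derived functor of a right exact functor $F$ and $\mathbb{R}_1F$ the first right derived functor of a left exact functor $F$; $(\mathbb{L}_1F)(\mathcal{C})=0$ means $(\mathbb{L}_1F)(C)=0$ for all $C\in\mathcal{C}$ (similarly for $\mathbb{R}_1$). For a class $\mathcal{C}$ of objects of an abelian category, $\mathcal{C}^\perp=\{X\mid \operatorname{Ext}^1(C,X)=0\ \forall C\in\mathcal{C}\}$ and ${}^\perp\mathcal{C}=\{X\mid \operatorname{Ext}^1(X,C)=0\ \forall C\in\mathcal{C}\}$. A pair $(\mathcal{C},\mathcal{D})$ is a cotorsion pair if $\mathcal{C}^\perp=\mathcal{D}$ and ${}^\perp\mathcal{D}=\mathcal{C}$. For classes $\mathcal{X}\subseteq\mathcal{A}'$ and $\mathcal{Y}\subseteq\mathcal{A}''$: $\mathcal{N}^{\mathcal{X}}_{\mathcal{Y}}=\{X\in\mathcal{A}\mid i^!X\in\mathcal{X},\ j^*X\in\mathcal{Y},\ (\mathbb{R}_1i^!)(X)=0\}$, $\mathcal{M}^{\mathcal{X}}_{\mathcal{Y}}=\{X\in\mathcal{A}\mid i^*X\in\mathcal{X},\ j^*X\in\mathcal{Y},\ (\mathbb{L}_1i^* )(X)=0\}$. *)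

(* Defs.v *)
From mathcomp Require Import all_boot all_algebra.
From mathcomp Require Import boolp classical_sets.

Set Implicit Arguments.
Unset Strict Implicit.
Unset Printing Implicit Defensive.

Import GRing.Theory.
Local Open Scope ring_scope.
Local Open Scope classical_set_scope.

Reserved Notation "g ∘ f" (at level 40, left associativity).

Record preadditive_category := PreadditiveCategory {
  ob :> Type;
  hom : ob -> ob -> zmodType;
  idm : forall X, hom X X;
  comp : forall X Y Z, hom Y Z -> hom X Y -> hom X Z;
  comp1m : forall X Y (f : hom X Y), comp (idm Y) f = f;
  compm1 : forall X Y (f : hom X Y), comp f (idm X) = f;
  compA : forall X Y Z W (h : hom Z W) (g : hom Y Z) (f : hom X Y),
    comp h (comp g f) = comp (comp h g) f;
  compDl : forall X Y Z (g g' : hom Y Z) (f : hom X Y),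
    comp (g + g') f = comp g f + comp g' f;
  compDr : forall X Y Z (g : hom Y Z) (f f' : hom X Y),
    comp g (f + f') = comp g f + comp g f'
}.

Arguments hom {p} X Y.
Arguments idm {p} X.
Arguments comp {p X Y Z} g f.

Notation "g ∘ f" := (comp g f).

Section Preadditive.
Variable A : preadditive_category.
Implicit Types X Y Z : A.

Definition mono X Y (f : hom X Y) : Prop :=
  forall Z (g h : hom Z X), f ∘ g = f ∘ h -> g = h.

Definition epi X Y (f : hom X Y) : Prop :=
  forall Z (g h : hom Y Z), g ∘ f = h ∘ f -> g = h.

Definition is_iso X Y (f : hom X Y) : Prop :=
  exists g : hom Y X, g ∘ f = idm X /\ f ∘ g = idm Y.

Definition isomorphic X Y : Prop := exists f : hom X Y, is_iso f.

Definition is_zero X : Prop :=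
  (forall Y (f : hom X Y), f = 0) /\ (forall Y (f : hom Y X), f = 0).

Definition projective P : Prop :=
  forall X Y (e : hom X Y) (f : hom P Y), epi e ->
    exists g : hom P X, e ∘ g = f.

Definition injective_object I : Prop :=
  forall X Y (m : hom X Y) (f : hom X I), mono m ->
    exists g : hom Y I, g ∘ m = f.

Definition is_kernel X Y (f : hom X Y) K (k : hom K X) : Prop :=
  f ∘ k = 0 /\
  forall Z (g : hom Z X), f ∘ g = 0 -> exists! h : hom Z K, k ∘ h = g.

Definition is_cokernel X Y (f : hom X Y) C (c : hom Y C) : Prop :=
  c ∘ f = 0 /\
  forall Z (g : hom Y Z), g ∘ f = 0 -> exists! h : hom C Z, h ∘ c = g.

Lemma comp0m X Y Z (f : hom X Y) : (0 : hom Y Z) ∘ f = 0.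
Proof. by apply: (addIr (0 ∘ f)); rewrite -compDl !add0r. Qed.

Lemma compm0 X Y Z (g : hom Y Z) : g ∘ (0 : hom X Y) = 0.
Proof. by apply: (addIr (g ∘ 0)); rewrite -compDr !add0r. Qed.

End Preadditive.

(* Abelian categories with enough projectives and injectives.  Kernels,
   cokernels, biproducts, projective presentations and injective embeddings
   are chosen, so that derived functors have actual values on objects. *)
Record abelian_category := AbelianCategory {
  abelian_base :> preadditive_category;
  zero_exists : exists Z : abelian_base, is_zero Z;
  bip : abelian_base -> abelian_base -> abelian_base;
  in1 : forall X Y, hom X (bip X Y);
  in2 : forall X Y, hom Y (bip X Y);
  pr1 : forall X Y, hom (bip X Y) X;
  pr2 : forall X Y, hom (bip X Y) Y;
  pr1in1 : forall X Y, pr1 X Y ∘ in1 X Y = idm X;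
  pr2in2 : forall X Y, pr2 X Y ∘ in2 X Y = idm Y;
  pr1in2 : forall X Y, pr1 X Y ∘ in2 X Y = 0;
  pr2in1 : forall X Y, pr2 X Y ∘ in1 X Y = 0;
  bip_id : forall X Y,
    in1 X Y ∘ pr1 X Y + in2 X Y ∘ pr2 X Y = idm (bip X Y);
  ker : forall X Y : abelian_base, hom X Y -> abelian_base;
  ker_in : forall (X Y : abelian_base) (f : hom X Y), hom (ker f) X;
  kerP : forall (X Y : abelian_base) (f : hom X Y), is_kernel f (ker_in f);
  coker : forall X Y : abelian_base, hom X Y -> abelian_base;
  coker_pr : forall (X Y : abelian_base) (f : hom X Y), hom Y (coker f);
  cokerP : forall (X Y : abelian_base) (f : hom X Y),
    is_cokernel f (coker_pr f);
  mono_normal : forall (X Y : abelian_base) (m : hom X Y), mono m ->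
    exists (Z : abelian_base) (f : hom Y Z), is_kernel f m;
  epi_normal : forall (X Y : abelian_base) (e : hom X Y), epi e ->
    exists (Z : abelian_base) (f : hom Z X), is_cokernel f e;
  proj : abelian_base -> abelian_base;
  proj_epi : forall X, hom (proj X) X;
  projP : forall X, projective (proj X);
  proj_epiP : forall X, epi (proj_epi X);
  inj : abelian_base -> abelian_base;
  inj_mono : forall X, hom X (inj X);
  injP : forall X, injective_object (inj X);
  inj_monoP : forall X, mono (inj_mono X)
}.

Section Homology.
Variable A : abelian_category.
Implicit Types X Y Z : A.

Definition ker_lift X Y Z (f : hom X Y) (g : hom Y Z) (gf0 : g ∘ f = 0) :
    hom X (ker g) :=
  sval (cid ((kerP g).2 X f gf0)).

Lemma ker_liftE X Y Z (f : hom X Y) (g : hom Y Z) (gf0 : g ∘ f = 0) :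
  ker_in g ∘ ker_lift gf0 = f.
Proof. by case: (svalP (cid ((kerP g).2 X f gf0))). Qed.

(* ker g / im f for a complex X -f-> Y -g-> Z *)
Definition homology X Y Z (f : hom X Y) (g : hom Y Z) (gf0 : g ∘ f = 0) : A :=
  coker (ker_lift gf0).

(* Start of a projective resolution
   proj (syz (syz X)) -pd2-> proj (syz X) -pd1-> proj X -> X -> 0. *)
Definition syz X : A := ker (proj_epi X).

Definition pd1 X : hom (proj (syz X)) (proj X) :=
  ker_in (proj_epi X) ∘ proj_epi (syz X).

Definition pd2 X : hom (proj (syz (syz X))) (proj (syz X)) := pd1 (syz X).

Lemma pd1_pd2 X : pd1 X ∘ pd2 X = 0.
Proof.
rewrite /pd2 /pd1 -compA (compA (proj_epi (syz X))).
by rewrite (kerP (proj_epi (syz X))).1 comp0m compm0.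
Qed.

(* Start of an injective resolution
   0 -> X -> inj X -id0-> inj (cosyz X) -id1-> inj (cosyz (cosyz X)). *)
Definition cosyz X : A := coker (inj_mono X).

Definition id0 X : hom (inj X) (inj (cosyz X)) :=
  inj_mono (cosyz X) ∘ coker_pr (inj_mono X).

Definition id1 X : hom (inj (cosyz X)) (inj (cosyz (cosyz X))) :=
  id0 (cosyz X).

Lemma id1_id0 X : id1 X ∘ id0 X = 0.
Proof.
rewrite /id1 /id0 -compA (compA (coker_pr (inj_mono (cosyz X)))).
by rewrite (cokerP (inj_mono (cosyz X))).1 comp0m compm0.
Qed.

End Homology.

Section Ext.
Variable A : abelian_category.
Implicit Types C X : A.

Record extension C X := Extension {
  ext_ob : A;
  ext_in : hom X ext_ob;
  ext_pr : hom ext_ob C;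
  ext_ker : is_kernel ext_pr ext_in;
  ext_coker : is_cokernel ext_in ext_pr
}.

Definition ext_equiv C X (E E' : extension C X) : Prop :=
  exists phi : hom (ext_ob E) (ext_ob E'),
    [/\ is_iso phi, phi ∘ ext_in E = ext_in E' & ext_pr E' ∘ phi = ext_pr E].

Lemma bip_kernel X C : is_kernel (pr2 X C) (in1 X C).
Proof.
split=> [|Z g g0]; first exact: pr2in1.
exists (pr1 X C ∘ g); split=> [|h <-]; last by rewrite compA pr1in1 comp1m.
by rewrite -[RHS]comp1m -bip_id compDl -!compA g0 compm0 addr0.
Qed.

Lemma bip_cokernel X C : is_cokernel (in1 X C) (pr2 X C).
Proof.
split=> [|Z g g0]; first exact: pr2in1.
exists (g ∘ in2 X C); split=> [|h <-]; last by rewrite -compA pr2in2 compm1.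
by rewrite -[RHS]compm1 -bip_id compDr !compA g0 comp0m add0r.
Qed.

Definition split_extension C X : extension C X :=
  Extension (bip_kernel X C) (bip_cokernel X C).

(* Ext^1(C, X), as the set of equivalence classes of extensions, is reduced to
   its zero element, the class of the split extension. *)
Definition Ext1_eq0 C X : Prop :=
  forall E : extension C X, ext_equiv E (split_extension C X).

Definition rperp (C : set A) : set A :=
  [set X | forall Y, C Y -> Ext1_eq0 Y X].

Definition lperp (C : set A) : set A :=
  [set X | forall Y, C Y -> Ext1_eq0 X Y].

Definition cotorsion_pair (C D : set A) : Prop :=
  rperp C = D /\ lperp D = C.

End Ext.

(* Additivity is automatic for the functors of a recollement, since each of
   them has an adjoint. *)
Record additive_functor (A B : abelian_category) := AdditiveFunctor {
  fob :> A -> B;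
  fmap : forall X Y : A, hom X Y -> hom (fob X) (fob Y);
  fmap1 : forall X : A, fmap (idm X) = idm (fob X);
  fmap_comp : forall (X Y Z : A) (g : hom Y Z) (f : hom X Y),
    fmap (g ∘ f) = fmap g ∘ fmap f;
  fmapD : forall (X Y : A) (f g : hom X Y), fmap (f + g) = fmap f + fmap g
}.

Arguments fmap {A B} F {X Y} f : rename.

Section Functors.
Variables A B : abelian_category.
Implicit Type F : additive_functor A B.

Definition fully_faithful F : Prop :=
  forall (X Y : A) (g : hom (F X) (F Y)), exists! f : hom X Y, fmap F f = g.

Lemma fmap0 F (X Y : A) : fmap F (0 : hom X Y) = 0.
Proof. by apply: (addIr (fmap F 0)); rewrite -fmapD !add0r. Qed.

Lemma fmap_complex F (X Y Z : A) (f : hom X Y) (g : hom Y Z) :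
  g ∘ f = 0 -> fmap F g ∘ fmap F f = 0.
Proof. by move=> gf0; rewrite -fmap_comp gf0 fmap0. Qed.

Definition L1 F (X : A) : B := homology (fmap_complex F (pd1_pd2 X)).

Definition R1 F (X : A) : B := homology (fmap_complex F (id1_id0 X)).

End Functors.

(* F is left adjoint to G. *)
Record adjunction (A B : abelian_category)
    (F : additive_functor A B) (G : additive_functor B A) := Adjunction {
  unit_adj : forall X : A, hom X (G (F X));
  counit_adj : forall Y : B, hom (F (G Y)) Y;
  unit_nat : forall (X X' : A) (f : hom X X'),
    fmap G (fmap F f) ∘ unit_adj X = unit_adj X' ∘ f;
  counit_nat : forall (Y Y' : B) (g : hom Y Y'),
    g ∘ counit_adj Y = counit_adj Y' ∘ fmap F (fmap G g);
  triangle_left : forall X : A,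
    counit_adj (F X) ∘ fmap F (unit_adj X) = idm (F X);
  triangle_right : forall Y : B,
    fmap G (counit_adj Y) ∘ unit_adj (G Y) = idm (G Y)
}.

(* Subscripts and superscripts are spelled out: i_up = i^*, i_low = i_*,
   i_sharp = i^!, j_shriek = j_!, j_up = j^*, j_low = j_*. *)
Record recollement (A' A A'' : abelian_category) := Recollement {
  i_up : additive_functor A A';
  i_low : additive_functor A' A;
  i_sharp : additive_functor A A';
  j_shriek : additive_functor A'' A;
  j_up : additive_functor A A'';
  j_low : additive_functor A'' A;
  adj_iup_ilow : adjunction i_up i_low;
  adj_ilow_isharp : adjunction i_low i_sharp;
  adj_jshriek_jup : adjunction j_shriek j_up;
  adj_jup_jlow : adjunction j_up j_low;
  i_low_ff : fully_faithful i_low;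
  j_shriek_ff : fully_faithful j_shriek;
  j_low_ff : fully_faithful j_low;
  ker_jup_im_ilow :
    [set X : A | is_zero (j_up X)] =
    [set X : A | exists Y : A', isomorphic X (i_low Y)]
}.

Section Recollement.
Variables A' A A'' : abelian_category.
Variable R : recollement A' A A''.

Definition condition_P : Prop :=
  forall P : A, projective P -> mono (counit_adj (adj_jshriek_jup R) P).

Definition N_class (X : set A') (Y : set A'') : set A :=
  [set Z | [/\ X (i_sharp R Z), Y (j_up R Z) & is_zero (R1 (i_sharp R) Z)]].

Definition M_class (X : set A') (Y : set A'') : set A :=
  [set Z | [/\ X (i_up R Z), Y (j_up R Z) & is_zero (L1 (i_up R) Z)]].

End Recollement.

(* Main.v *)
(* Writing [Ext^1] through lifting problems along a projective or injective
   presentation, [L1 F U = 0] for [F] left adjoint to [G] means that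
   [Ext^1(U, G I) = 0] for all injective [I], and it gives
   [Ext^1(U, G X) = 0 <-> Ext^1(F U, X) = 0] when [G] preserves epimorphisms;
   dually for [R1].  Hence [i_low U'] and [j_shriek U''] lie in [M], and
   [i_low V'] and [j_low V''] lie in [N]; testing against these objects gives
   [rperp M <= N] and [lperp N <= M].

   Condition (P) enters only in [Ext^1(M, N) = 0].  It makes the unit
   [I -> j_low (j_up I)] epi for [I] injective, with kernel [i_low] of an
   injective object, so if [L1 i_up M = 0] then every map from
   [j_shriek (j_up M)] to [I] extends to [M]: the counit at [M] is mono.  So [M]
   is an extension of [i_low (i_up M)] by [j_shriek (j_up M)], and both have no
   [Ext^1] into [N]. *)
From mathcomp Require Import all_boot ssralg.
From mathcomp Require Import boolp classical_sets.
Require Import Defs.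

Set Implicit Arguments.
Unset Strict Implicit.
Unset Printing Implicit Defensive.

Import GRing.Theory.
Local Open Scope ring_scope.
Local Open Scope classical_set_scope.

(** * Opposite categories, functors and adjunctions *)

Section Opposite.

(** Only composition is reversed, so a kernel in the opposite category is a cokernel by conversion,
    and a mono an epi; dual lemmas then follow by [exact]. *)
Definition opp_pre (A : preadditive_category) : preadditive_category :=
  @PreadditiveCategory A (fun X Y => hom Y X) (fun X => idm X)
    (fun X Y Z g f => f ∘ g)
    (fun X Y f => compm1 f) (fun X Y f => comp1m f)
    (fun X Y Z W h g f => esym (compA f g h))
    (fun X Y Z g g' f => compDr f g g') (fun X Y Z g f f' => compDl f f' g).

Variable A : abelian_category.

Lemma zero_exists_opp : exists Z : opp_pre A, is_zero Z.
Proof. by have [Z [Z1 Z2]] := zero_exists A; exists Z. Qed.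

Definition opp : abelian_category :=
  @AbelianCategory (opp_pre A) zero_exists_opp (@bip A)
    (@pr1 A) (@pr2 A) (@in1 A) (@in2 A)
    (@pr1in1 A) (@pr2in2 A) (@pr2in1 A) (@pr1in2 A) (@bip_id A)
    (fun X Y f => @coker A Y X f) (fun X Y f => @coker_pr A Y X f)
    (fun X Y f => @cokerP A Y X f)
    (fun X Y f => @ker A Y X f) (fun X Y f => @ker_in A Y X f)
    (fun X Y f => @kerP A Y X f)
    (fun X Y m => @epi_normal A Y X m) (fun X Y e => @mono_normal A Y X e)
    (@inj A) (@inj_mono A)
    (fun X Y Z e f => @injP A X Z Y e f) (@inj_monoP A)
    (@proj A) (@proj_epi A)
    (fun X Y Z e f => @projP A X Z Y e f) (@proj_epiP A).

End Opposite.

Definition opp_functor (A B : abelian_category) (F : additive_functor A B) :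
    additive_functor (opp A) (opp B) :=
  @AdditiveFunctor (opp A) (opp B) F (fun X Y f => fmap F f) (fmap1 F)
    (fun X Y Z g f => fmap_comp F f g) (fun X Y f g => fmapD F f g).

Definition opp_adjunction (A B : abelian_category)
    (F : additive_functor A B) (G : additive_functor B A)
    (adj : adjunction F G) : adjunction (opp_functor G) (opp_functor F) :=
  @Adjunction (opp B) (opp A) (opp_functor G) (opp_functor F)
    (counit_adj adj) (unit_adj adj)
    (fun X X' f => esym (counit_nat adj f))
    (fun Y Y' g => esym (unit_nat adj g))
    (triangle_right adj) (triangle_left adj).

(** * Monos, epis, kernels, cokernels and short exact sequences *)

Section Preadditive.
Variable A : preadditive_category.
Implicit Types X Y Z W : A.

Lemma compNl X Y Z (g : hom Y Z) (f : hom X Y) : (- g) ∘ f = - (g ∘ f).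
Proof. by apply: (addIr (g ∘ f)); rewrite -compDl !addNr comp0m. Qed.

Lemma compNr X Y Z (g : hom Y Z) (f : hom X Y) : g ∘ (- f) = - (g ∘ f).
Proof. by apply: (addIr (g ∘ f)); rewrite -compDr !addNr compm0. Qed.

Lemma compBl X Y Z (g g' : hom Y Z) (f : hom X Y) :
  (g - g') ∘ f = g ∘ f - g' ∘ f.
Proof. by rewrite compDl compNl. Qed.

Lemma compBr X Y Z (g : hom Y Z) (f f' : hom X Y) :
  g ∘ (f - f') = g ∘ f - g ∘ f'.
Proof. by rewrite compDr compNr. Qed.

Lemma mono_eq0 X Y Z (f : hom X Y) (g : hom Z X) :
  mono f -> f ∘ g = 0 -> g = 0.
Proof. by move=> fm fg; apply: fm; rewrite compm0. Qed.

Lemma monoP X Y (f : hom X Y) :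
  (forall Z (g : hom Z X), f ∘ g = 0 -> g = 0) -> mono f.
Proof.
move=> H Z g h e; apply/eqP; rewrite -subr_eq0; apply/eqP/H.
by rewrite compBr e subrr.
Qed.

Lemma epi_eq0 X Y Z (f : hom X Y) (g : hom Y Z) :
  epi f -> g ∘ f = 0 -> g = 0.
Proof. by move=> fe gf; apply: fe; rewrite comp0m. Qed.

Lemma mono_of_comp X Y Z (f : hom X Y) (g : hom Y Z) : mono (g ∘ f) -> mono f.
Proof. by move=> m W a b e; apply: m; rewrite -!compA e. Qed.

Lemma epi_of_comp X Y Z (f : hom X Y) (g : hom Y Z) : epi (g ∘ f) -> epi g.
Proof. by move=> m W a b e; apply: m; rewrite !compA e. Qed.

Lemma kernel_mono X Y K (f : hom X Y) (k : hom K X) : is_kernel f k -> mono k.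
Proof.
move=> [fk kP] Z g h e.
have [|m [_ mU]] := kP Z (k ∘ g); first by rewrite compA fk comp0m.
by rewrite -(mU g) // -(mU h).
Qed.

Lemma kernel_lift X Y K Z (f : hom X Y) (k : hom K X) (g : hom Z X) :
  is_kernel f k -> f ∘ g = 0 -> exists h, k ∘ h = g.
Proof. by move=> [_ kP] /kP [h [hE _]]; exists h. Qed.

Lemma is_kernelI X Y K (f : hom X Y) (k : hom K X) :
  mono k -> f ∘ k = 0 ->
  (forall Z (g : hom Z X), f ∘ g = 0 -> exists h, k ∘ h = g) -> is_kernel f k.
Proof.
move=> km fk kP; split=> // Z g /kP [h hE]; exists h; split=> // h' h'E.
by apply: km; rewrite hE.
Qed.

Lemma is_zeroP X : idm X = 0 -> is_zero X.
Proof.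
by move=> e; split=> Y f; [rewrite -(compm1 f)|rewrite -(comp1m f)];
  rewrite e ?compm0 ?comp0m.
Qed.

Lemma isomorphic_sym X Y : isomorphic X Y -> isomorphic Y X.
Proof. by move=> [f [g [gf fg]]]; exists g, f. Qed.

End Preadditive.

Section PreadditiveDual.
Variable A : preadditive_category.
Implicit Types X Y Z : A.

Lemma epiP X Y (f : hom X Y) :
  (forall Z (g : hom Y Z), g ∘ f = 0 -> g = 0) -> epi f.
Proof. exact: (@monoP (opp_pre A) Y X f). Qed.

Lemma cokernel_epi X Y C (f : hom X Y) (c : hom Y C) : is_cokernel f c -> epi c.
Proof. exact: (@kernel_mono (opp_pre A) Y X C f c). Qed.

Lemma cokernel_desc X Y C Z (f : hom X Y) (c : hom Y C) (g : hom Y Z) :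
  is_cokernel f c -> g ∘ f = 0 -> exists h, h ∘ c = g.
Proof. exact: (@kernel_lift (opp_pre A) Y X C Z f c g). Qed.

Lemma is_cokernelI X Y C (f : hom X Y) (c : hom Y C) :
  epi c -> c ∘ f = 0 ->
  (forall Z (g : hom Y Z), g ∘ f = 0 -> exists h, h ∘ c = g) ->
  is_cokernel f c.
Proof. exact: (@is_kernelI (opp_pre A) Y X C f c). Qed.

Definition short_exact X E C (i : hom X E) (p : hom E C) : Prop :=
  is_kernel p i /\ is_cokernel i p.

(** The map [idm E - i ∘ r] kills [i], so it factors through [p]; the factor is the section. *)
Lemma short_exact_section X E C (i : hom X E) (p : hom E C) :
  short_exact i p -> (exists r, r ∘ i = idm X) -> exists s, p ∘ s = idm C.
Proof.
move=> [ik pc] [r ri].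
have [|s sE] := cokernel_desc (g := idm E - i ∘ r) pc.
  by rewrite compBl comp1m -compA ri compm1 subrr.
exists s; apply: (cokernel_epi pc).
by rewrite -compA sE compBr compm1 compA ik.1 comp0m subr0 comp1m.
Qed.

End PreadditiveDual.

(** * Pullbacks of extensions and Ext^1 through lifting *)

Section Abelian.
Variable A : abelian_category.
Implicit Types X Y Z W : A.

(** By normality [e] is the cokernel of some [f], and [f] factors through [k]; hence whatever kills
    [k] kills [f]. *)
Lemma cokernel_of_kernel X Y Z (k : hom X Y) (e : hom Y Z) :
  is_kernel e k -> epi e -> is_cokernel k e.
Proof.
move=> [ek kP] ee; apply: is_cokernelI => // W g gk.
have [V [f [ef fP]]] := epi_normal ee.
have [h [hE _]] := kP V f ef.
by apply: (cokernel_desc (conj ef fP)); rewrite -hE compA gk comp0m.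
Qed.

Lemma short_exact_ker X Y (e : hom X Y) : epi e -> short_exact (ker_in e) e.
Proof. by move=> ee; split; [|apply: cokernel_of_kernel]; try exact: kerP. Qed.

(** The pullback of [p] and [f] is built as the kernel of their difference [d] on the biproduct. *)
Lemma pullback_short_exact X E L C (i : hom X E) (p : hom E L) (f : hom C L) :
  short_exact i p -> exists (P : A) (a : hom X P) (q : hom P C) (h : hom P E),
    short_exact a q /\ p ∘ h = f ∘ q.
Proof.
move=> [ik pc]; pose d := p ∘ pr1 E C - f ∘ pr2 E C.
have din1 : d ∘ in1 E C = p.
  by rewrite compBl -!compA pr1in1 pr2in1 compm0 compm1 subr0.
have de : epi d by apply: (@epi_of_comp _ _ _ _ (in1 E C)); rewrite din1;
  apply: cokernel_epi pc.
have [kk kc] := short_exact_ker de.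
set k := ker_in d in kk kc.
have km := kernel_mono kk.
have sq : p ∘ (pr1 E C ∘ k) = f ∘ (pr2 E C ∘ k).
  by apply/eqP; rewrite -subr_eq0 !compA -compBl kk.1.
have dai : d ∘ (in1 E C ∘ i) = 0 by rewrite compA din1 ik.1.
have [a aE] := kernel_lift kk dai.
exists (ker d), a, (pr2 E C ∘ k), (pr1 E C ∘ k); split=> //.
(* If [u] kills this map, then [u ∘ pr2 E C] is [v ∘ d] for some [v]; restricting to the summand [E]
   gives [v ∘ p = 0], hence [v = 0]. *)
have qe : epi (pr2 E C ∘ k).
  apply: epiP => Z u; rewrite compA => uk.
  have [v vE] := cokernel_desc kc uk.
  have v0 : v = 0.
    apply: (epi_eq0 (cokernel_epi pc)).
    by rewrite -din1 compA vE -compA pr2in1 compm0.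
  have : u ∘ pr2 E C ∘ in2 E C = 0 by rewrite -vE v0 !comp0m.
  by rewrite -compA pr2in2 compm1.
have aker : is_kernel (pr2 E C ∘ k) a.
  apply: is_kernelI.
  - apply: (@mono_of_comp _ _ _ _ _ (pr1 E C ∘ k)).
    by rewrite -compA aE compA pr1in1 comp1m; apply: kernel_mono ik.
  - by rewrite -compA aE compA pr2in1 comp0m.
  - move=> Z g; rewrite -compA => g0.
    have [|h hE] := kernel_lift (g := pr1 E C ∘ (k ∘ g)) ik.
      by rewrite (compA (pr1 E C)) compA sq -!compA g0 compm0.
    exists h; apply: km; rewrite compA aE -compA hE.
    by rewrite -[RHS]comp1m -bip_id compDl -!compA g0 compm0 addr0.
by split=> //; apply: cokernel_of_kernel.
Qed.

(** A section [s] yields a retraction [r] with [i ∘ r = idm E - s ∘ p], and [r] and [p] are the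
    components of an isomorphism onto the split extension. *)
Lemma Ext1_eq0P C X : Ext1_eq0 C X <->
  forall E (i : hom X E) (p : hom E C), short_exact i p ->
    exists s, p ∘ s = idm C.
Proof.
split=> [H E i p [ik pc]|H [E i p ik pc]].
  have [phi [[psi [_ phipsi]] _ /= pE]] := H (Extension ik pc).
  exists (psi ∘ in2 X C).
  rewrite -(congr1 (fun q => q ∘ _) pE) -compA (compA phi) phipsi.
  by rewrite comp1m pr2in2.
have [s ps] := H E i p (conj ik pc).
have [|r rE] := kernel_lift (g := idm E - s ∘ p) ik.
  by rewrite compBr compm1 compA ps comp1m subrr.
have im := kernel_mono ik.
have ri : r ∘ i = idm X.
  by apply: im; rewrite compA rE compBl comp1m -compA ik.1 compm0 subr0 compm1.
have rs : r ∘ s = 0.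
  by apply: im; rewrite compA rE compBl comp1m -compA ps compm1 subrr compm0.
exists (in1 X C ∘ r + in2 X C ∘ p); split=> /=.
- exists (i ∘ pr1 X C + s ∘ pr2 X C); split.
    rewrite compDl !compDr -!compA !(compA (pr1 X C)) !(compA (pr2 X C)).
    rewrite pr1in1 pr1in2 pr2in1 pr2in2 !comp0m !comp1m !compm0 addr0 add0r rE.
    by rewrite subrK.
  rewrite compDl !compDr -!compA !(compA r) !(compA p) ri rs ps ik.1.
  by rewrite !comp0m !comp1m !compm0 addr0 add0r bip_id.
- by rewrite compDl -!compA ri ik.1 compm1 compm0 addr0.
- by rewrite compDr !compA pr2in1 pr2in2 comp0m comp1m add0r.
Qed.

(** A section of the pullback along [f] is a lift of [f]. Conversely, [i] extends to [h] on [E] by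
    injectivity and induces a map from [C] to [L]; subtracting from [h] a lift of that map leaves a
    retraction onto [X]. *)
Lemma Ext1_eq0_injective C X I L (i : hom X I) (p : hom I L) :
  injective_object I -> short_exact i p ->
  Ext1_eq0 C X <-> forall f : hom C L, exists g, p ∘ g = f.
Proof.
move=> Iinj ip; have im := kernel_mono ip.1.
rewrite Ext1_eq0P; split=> [H f|H E a q aq].
  have [P [a [q [h [aq e]]]]] := pullback_short_exact f ip.
  have [s qs] := H _ _ _ aq.
  by exists (h ∘ s); rewrite compA e -compA qs compm1.
apply: (short_exact_section aq).
have [h hE] := Iinj _ _ _ i (kernel_mono aq.1).
have [|f fE] := cokernel_desc (g := p ∘ h) aq.2.
  by rewrite -compA hE ip.1.1.
have [g gE] := H f.
have [|r rE] := kernel_lift (g := h - g ∘ q) ip.1.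
  by rewrite compBr compA gE fE subrr.
exists r; apply: im.
by rewrite compA rE compBl hE -compA aq.1.1 compm0 subr0 compm1.
Qed.

End Abelian.

(** * Dual statements, Ext^1 of extensions, and vanishing of homology *)

Section Duality.
Variable A : abelian_category.
Implicit Types X Y Z C : A.

Lemma kernel_of_cokernel X Y Z (m : hom X Y) (c : hom Y Z) :
  is_cokernel m c -> mono m -> is_kernel c m.
Proof. exact: (@cokernel_of_kernel (opp A) Z Y X c m). Qed.

Lemma short_exact_coker X Y (m : hom X Y) :
  mono m -> short_exact m (coker_pr m).
Proof. by move=> /(@short_exact_ker (opp A) Y X m) []. Qed.

(** A section in one category is a retraction in the other, and a short exact sequence with one has
    both. *)
Lemma Ext1_eq0_opp C X : @Ext1_eq0 (opp A) X C <-> Ext1_eq0 C X.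
Proof.
rewrite !Ext1_eq0P; split=> H E i p [ik pc].
  apply: (@short_exact_section A _ _ _ i p) => //.
  exact: (H E p i (conj pc ik)).
apply: (@short_exact_section (opp A) _ _ _ i p) => //.
exact: (H E p i (conj pc ik)).
Qed.

Lemma Ext1_eq0_projective C X K P (k : hom K P) (p : hom P C) :
  projective P -> short_exact k p ->
  Ext1_eq0 C X <-> forall f : hom K X, exists g, g ∘ k = f.
Proof.
move=> Pproj [kk pc]; rewrite -Ext1_eq0_opp.
apply: (@Ext1_eq0_injective (opp A) X C P K p k) => // Y Z m f.
exact: Pproj.
Qed.

Lemma inj_short_exact X : short_exact (inj_mono X) (coker_pr (inj_mono X)).
Proof. exact/short_exact_coker/inj_monoP. Qed.

Lemma proj_short_exact X : short_exact (ker_in (proj_epi X)) (proj_epi X).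
Proof. exact/short_exact_ker/proj_epiP. Qed.

Lemma Ext1_eq0_zerol Z X : is_zero Z -> Ext1_eq0 Z X.
Proof.
move=> [Z0 _]; rewrite (Ext1_eq0_injective _ (@injP A X) (inj_short_exact X)).
by move=> f; exists 0; rewrite compm0 (Z0 _ f).
Qed.

Lemma Ext1_eq0_isol C C' X : isomorphic C C' -> Ext1_eq0 C X -> Ext1_eq0 C' X.
Proof.
move=> [u [v [_ uv]]].
rewrite !(Ext1_eq0_injective _ (@injP A X) (inj_short_exact X)) => H f.
by have [g gE] := H (f ∘ u); exists (g ∘ v); rewrite compA gE -compA uv compm1.
Qed.

(** Lift [f] on [M'], extend that lift to [M] by injectivity, and correct it by a lift of the
    difference, which factors through [M'']. *)
Lemma Ext1_eq0_extension M' M M'' X (i : hom M' M) (p : hom M M'') :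
  short_exact i p -> Ext1_eq0 M' X -> Ext1_eq0 M'' X -> Ext1_eq0 M X.
Proof.
move=> ip; rewrite !(Ext1_eq0_injective _ (@injP A X) (inj_short_exact X)).
set q := coker_pr _ => H' H'' f.
have [g' g'E] := H' (f ∘ i).
have [g gE] := injP g' (kernel_mono ip.1).
have [|f'' f''E] := cokernel_desc (g := f - q ∘ g) ip.2.
  by rewrite compBl -compA gE g'E subrr.
have [g'' g''E] := H'' f''.
by exists (g + g'' ∘ p); rewrite compDr compA g''E f''E addrC subrK.
Qed.

Lemma injective_Ext1_eq0 C I : injective_object I -> Ext1_eq0 C I.
Proof.
move=> Iinj; apply/Ext1_eq0P => E i p ip; apply: (short_exact_section ip).
exact: Iinj (kernel_mono ip.1).
Qed.

Lemma homology_zero X Y Z (f : hom X Y) (g : hom Y Z) (gf0 : g ∘ f = 0) :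
  is_zero (homology gf0) <-> epi (ker_lift gf0).
Proof.
have [c0 cP] := cokerP (ker_lift gf0); split=> [[_ H0]|le].
  apply: epiP => W w wl; have [h [<- _]] := cP W w wl.
  by rewrite (H0 _ (coker_pr _)) compm0.
apply/is_zeroP/(cokernel_epi (cokerP (ker_lift gf0))).
by rewrite comp1m comp0m; apply: (epi_eq0 le).
Qed.

Lemma homology_zero_projective X Y Z (f : hom X Y) (g : hom Y Z)
    (gf0 : g ∘ f = 0) :
  is_zero (homology gf0) <->
  forall P (u : hom P Y), projective P -> g ∘ u = 0 -> exists v, f ∘ v = u.
Proof.
rewrite homology_zero; split=> [le P u Pproj gu|H].
  have [u' u'E] := kernel_lift (kerP g) gu.
  have [v vE] := Pproj _ _ _ u' le.
  by exists v; rewrite -u'E -vE compA ker_liftE.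
have [|v vE] := H (proj (ker g)) (ker_in g ∘ proj_epi (ker g)) (@projP _ _).
  by rewrite compA (kerP g).1 comp0m.
apply: (@epi_of_comp _ _ _ _ v).
suff -> : ker_lift gf0 ∘ v = proj_epi (ker g) by apply: proj_epiP.
by apply: (kernel_mono (kerP g)); rewrite compA ker_liftE.
Qed.

(** Proved directly, since [homology] is a cokernel over a kernel and is not self-dual by
    conversion. *)
Lemma homology_zero_injective X Y Z (f : hom X Y) (g : hom Y Z)
    (gf0 : g ∘ f = 0) :
  is_zero (homology gf0) <->
  forall I (u : hom Y I), injective_object I -> u ∘ f = 0 ->
    exists v, v ∘ g = u.
Proof.
rewrite homology_zero; have km := kernel_mono (kerP g).
split=> [le I u Iinj uf|H].
  have uk : u ∘ ker_in g = 0.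
    by apply: (epi_eq0 le); rewrite -compA ker_liftE.
  have [kk kc] := short_exact_coker km.
  have [g' g'E] := cokernel_desc kc (kerP g).1.
  have [u' u'E] := cokernel_desc kc uk.
  suff g'm : mono g'.
    by have [v vE] := Iinj _ _ _ u' g'm; exists v; rewrite -g'E compA vE.
  (* [g'] is the inclusion of the coimage of [g]: pull an element of its
     kernel back along [Y -> coim g]. *)
  apply: monoP => W w g'w.
  have [P [a [q [h [[_ qc] e]]]]] := pullback_short_exact w (conj kk kc).
  apply: (epi_eq0 (cokernel_epi qc)); rewrite -e.
  have [|h' <-] := kernel_lift (g := h) (kerP g).
    by rewrite -g'E -compA e compA g'w comp0m.
  by rewrite compA kk.1 comp0m.
(* Embed [W] in an injective and extend from [ker g] to [Y]: the extension kills [f], so it factors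
   through [g] and vanishes on [ker g]. *)
apply: epiP => W w wl.
have [u uE] := injP (inj_mono W ∘ w) km.
have [|v vE] := H _ u (@injP _ _).
  by rewrite -(ker_liftE gf0) compA uE -compA wl compm0.
apply: (mono_eq0 (@inj_monoP _ W)).
by rewrite -uE -vE -compA (kerP g).1 compm0.
Qed.

End Duality.

Lemma Ext1_eq0_zeror (A : abelian_category) (C Z : A) :
  is_zero Z -> Ext1_eq0 C Z.
Proof.
by move=> [Z0 Z1]; apply/Ext1_eq0_opp; apply: (@Ext1_eq0_zerol (opp A)).
Qed.

Lemma Ext1_eq0_isor (A : abelian_category) (C X X' : A) :
  isomorphic X X' -> Ext1_eq0 C X -> Ext1_eq0 C X'.
Proof.
move=> [u [v [vu uv]]] /Ext1_eq0_opp H; apply/Ext1_eq0_opp.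
by apply: (@Ext1_eq0_isol (opp A)) H; exists v, u.
Qed.

Lemma projective_Ext1_eq0 (A : abelian_category) (P X : A) :
  projective P -> Ext1_eq0 P X.
Proof.
move=> Pproj; apply/Ext1_eq0P => E i p ip.
exact: Pproj (cokernel_epi ip.2).
Qed.

(** * Fully faithful functors reflect exactness *)

Lemma ff_faithful (A B : abelian_category) (F : additive_functor A B) :
  fully_faithful F ->
  forall (X Y : A) (f g : hom X Y), fmap F f = fmap F g -> f = g.
Proof.
move=> Fff X Y f g e; have [h [_ U]] := Fff _ _ (fmap F g).
by rewrite -(U f e) (U g).
Qed.

Lemma ff_reflect_kernel (A B : abelian_category) (F : additive_functor A B)
    (X Y K : A) (f : hom X Y) (k : hom K X) :
  fully_faithful F -> is_kernel (fmap F f) (fmap F k) -> is_kernel f k.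
Proof.
move=> Fff Fk; have Finj := ff_faithful Fff; apply: is_kernelI.
- move=> Z a b e; apply: Finj; apply: (kernel_mono Fk).
  by rewrite -!fmap_comp e.
- by apply: Finj; rewrite fmap_comp Fk.1 fmap0.
move=> Z g fg; have [|h hE] := kernel_lift (g := fmap F g) Fk.
  by rewrite -fmap_comp fg fmap0.
have [h' [h'E _]] := Fff _ _ h.
by exists h'; apply: Finj; rewrite fmap_comp h'E.
Qed.

Lemma ff_reflect_short_exact (A B : abelian_category)
    (F : additive_functor A B) (X E C : A) (i : hom X E) (p : hom E C) :
  fully_faithful F -> short_exact (fmap F i) (fmap F p) -> short_exact i p.
Proof.
move=> Fff [Fk Fc]; split; first exact: ff_reflect_kernel Fk.
apply: (@ff_reflect_kernel _ _ (opp_functor F) E X C i p) => //.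
by move=> Z W g; apply: Fff.
Qed.

(** * Adjoint transposes, left derived functors and Ext^1 *)

Section Adjunction.
Variables (A B : abelian_category).
Variables (F : additive_functor A B) (G : additive_functor B A).
Variable adj : adjunction F G.

Definition sharp (X : A) (Y : B) (f : hom X (G Y)) : hom (F X) Y :=
  counit_adj adj Y ∘ fmap F f.

Definition flat (X : A) (Y : B) (g : hom (F X) Y) : hom X (G Y) :=
  fmap G g ∘ unit_adj adj X.

Lemma flatK (X : A) (Y : B) (g : hom (F X) Y) : sharp (flat g) = g.
Proof.
by rewrite /sharp fmap_comp compA -counit_nat -compA triangle_left compm1.
Qed.

Lemma sharpK (X : A) (Y : B) (f : hom X (G Y)) : flat (sharp f) = f.
Proof.
by rewrite /flat fmap_comp -compA unit_nat compA triangle_right comp1m.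
Qed.

Lemma sharp_compr (X X' : A) (Y : B) (f : hom X (G Y)) (h : hom X' X) :
  sharp (f ∘ h) = sharp f ∘ fmap F h.
Proof. by rewrite /sharp fmap_comp compA. Qed.

Lemma flat_compr (X X' : A) (Y : B) (g : hom (F X) Y) (h : hom X' X) :
  flat (g ∘ fmap F h) = flat g ∘ h.
Proof. by rewrite -[in LHS](flatK g) -sharp_compr sharpK. Qed.

Lemma flat_compl (X : A) (Y Y' : B) (k : hom Y Y') (g : hom (F X) Y) :
  flat (k ∘ g) = fmap G k ∘ flat g.
Proof. by rewrite /flat fmap_comp compA. Qed.

Lemma sharp_compl (X : A) (Y Y' : B) (k : hom Y Y') (f : hom X (G Y)) :
  sharp (fmap G k ∘ f) = k ∘ sharp f.
Proof. by rewrite -[in LHS](sharpK f) -flat_compl flatK. Qed.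

Lemma sharp0 (X : A) (Y : B) : sharp (0 : hom X (G Y)) = 0.
Proof. by rewrite /sharp fmap0 compm0. Qed.

Lemma flat0 (X : A) (Y : B) : flat (0 : hom (F X) Y) = 0.
Proof. by rewrite /flat fmap0 comp0m. Qed.

Lemma flat_inj (X : A) (Y : B) (g g' : hom (F X) Y) :
  flat g = flat g' -> g = g'.
Proof. by move=> e; rewrite -(flatK g) e flatK. Qed.

Lemma left_adjoint_epi (X X' : A) (e : hom X X') : epi e -> epi (fmap F e).
Proof. by move=> ee Y g h E; apply/flat_inj/ee; rewrite -!flat_compr E. Qed.

Lemma left_adjoint_cokernel (X Y C : A) (f : hom X Y) (c : hom Y C) :
  is_cokernel f c -> is_cokernel (fmap F f) (fmap F c).
Proof.
move=> fc; apply: is_cokernelI.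
- exact/left_adjoint_epi/(cokernel_epi fc).
- by rewrite -fmap_comp fc.1 fmap0.
move=> Z g gf; have [|h hE] := cokernel_desc (g := flat g) fc.
  by rewrite -flat_compr gf flat0.
by exists (sharp h); rewrite -sharp_compr hE flatK.
Qed.

Lemma left_adjoint_projective (P : A) :
  (forall (X Y : B) (e : hom X Y), epi e -> epi (fmap G e)) ->
  projective P -> projective (F P).
Proof.
move=> Gepi Pproj X Y e f /Gepi ee.
have [g gE] := Pproj _ _ _ (flat f) ee.
by exists (sharp g); rewrite -sharp_compl gE flatK.
Qed.

(** Transposition turns maps from the image under [F] of the resolution into [I] into maps from the
    resolution into [G I]; exactness there says that maps [syz U -> G I] extend to [proj U]. *)
Lemma complex_acyclicP (U : A) :
  (forall (I : B) (u : hom (F (proj (syz U))) I), injective_object I ->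
     u ∘ fmap F (pd2 U) = 0 -> exists v, v ∘ fmap F (pd1 U) = u) <->
  (forall I : B, injective_object I -> Ext1_eq0 U (G I)).
Proof.
split=> H I => [Iinj|u Iinj upd].
  apply/(Ext1_eq0_projective _ (@projP _ _) (proj_short_exact U)) => f.
  have [|v vE] := H I (sharp (f ∘ proj_epi (syz U))) Iinj.
    rewrite -sharp_compr /pd2 /pd1 -compA (compA (proj_epi (syz U))).
    by rewrite (kerP _).1 comp0m compm0 sharp0.
  exists (flat v); apply: (@proj_epiP _ (syz U)).
  by rewrite -compA -[_ ∘ proj_epi _]/(pd1 U) -flat_compr vE sharpK.
have e1 := @proj_epiP _ (syz U).
have [|f fE] := cokernel_desc (g := flat u) (short_exact_ker e1).2.
  apply: (epi_eq0 (@proj_epiP _ _)).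
  by rewrite -compA -[_ ∘ proj_epi _]/(pd2 U) -flat_compr upd flat0.
have /(Ext1_eq0_projective _ (@projP _ _) (proj_short_exact U)) := H I Iinj.
move=> /(_ f) [g gE]; exists (sharp g).
by rewrite -sharp_compr /pd1 compA gE fE flatK.
Qed.

Lemma L1_zeroP (U : A) : is_zero (L1 F U) <->
  forall I : B, injective_object I -> Ext1_eq0 U (G I).
Proof. by rewrite /L1 homology_zero_injective complex_acyclicP. Qed.

(* As [L1 F U = 0], the functor [F] sends the short exact sequence
   [syz U -> proj U -> U] to a projective presentation of [F U]. *)
Lemma left_adjoint_Ext1 (U : A) (X : B) :
  (forall (X Y : B) (e : hom X Y), epi e -> epi (fmap G e)) ->
  (forall I : B, injective_object I -> Ext1_eq0 U (G I)) ->
  Ext1_eq0 U (G X) <-> Ext1_eq0 (F U) X.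
Proof.
move=> Gepi acyc; have ke := proj_short_exact U.
set k := ker_in _ in ke; have Pproj := @projP _ U.
(* An embedding of [F (syz U)] into an injective extends along [fmap F k], because its transpose
   extends along [k]. *)
have Fkm : mono (fmap F k).
  have := acyc _ (@injP _ (F (ker (proj_epi U)))).
  move=> /(Ext1_eq0_projective _ Pproj ke) /(_ (flat (inj_mono _))) [g gE].
  apply: (@mono_of_comp _ _ _ _ _ (sharp g)).
  by rewrite -sharp_compr gE flatK; apply: inj_monoP.
have Fc := left_adjoint_cokernel ke.2.
have Fke := conj (kernel_of_cokernel Fc Fkm) Fc.
rewrite (Ext1_eq0_projective _ Pproj ke).
rewrite (Ext1_eq0_projective _ (left_adjoint_projective Gepi Pproj) Fke).
split=> H f.
  have [g gE] := H (flat f).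
  by exists (sharp g); rewrite -sharp_compr gE flatK.
have [g gE] := H (sharp f).
by exists (flat g); rewrite -flat_compr gE sharpK.
Qed.

(** The inverse is the preimage under [G] of the unit at [G Y]. *)
Lemma right_ff_counit_iso : fully_faithful G ->
  forall Y : B, is_iso (counit_adj adj Y).
Proof.
move=> Gff Y; have [d [dE _]] := Gff _ _ (unit_adj adj (G Y)).
have inv : counit_adj adj Y ∘ d = idm Y.
  by apply: (ff_faithful Gff); rewrite fmap_comp dE triangle_right fmap1.
exists d; split=> //; apply: flat_inj.
by rewrite flat_compl /flat triangle_right compm1 dE fmap1 comp1m.
Qed.

End Adjunction.

(** * Right derived functors, through the opposite adjunction *)

Section AdjunctionDual.
Variables (A B : abelian_category).
Variables (F : additive_functor A B) (G : additive_functor B A).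
Variable adj : adjunction F G.

Lemma right_adjoint_mono (X Y : B) (m : hom X Y) : mono m -> mono (fmap G m).
Proof. exact: (left_adjoint_epi (opp_adjunction adj) (e := m)). Qed.

Lemma R1_zeroP (X : B) : is_zero (R1 G X) <->
  forall P : A, projective P -> Ext1_eq0 (F P) X.
Proof.
rewrite /R1 homology_zero_projective.
have [H1 H2] := complex_acyclicP (opp_adjunction adj) X.
split=> [H P Pproj|H P u Pproj].
  apply/Ext1_eq0_opp/H1 => [I u Iinj|Y Z m f]; last exact: Pproj.
  by apply: H => Y Z e f; apply: Iinj.
apply: H2 => [I Iinj|Y Z m f]; last exact: Pproj.
by apply/Ext1_eq0_opp/H => Y Z e f; apply: Iinj.
Qed.

Lemma right_adjoint_Ext1 (X : A) (V : B) :
  (forall (X Y : A) (m : hom X Y), mono m -> mono (fmap F m)) ->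
  (forall P : A, projective P -> Ext1_eq0 (F P) V) ->
  Ext1_eq0 (F X) V <-> Ext1_eq0 X (G V).
Proof.
move=> Fmono acyc; rewrite -(Ext1_eq0_opp (F X)) -(Ext1_eq0_opp X).
apply: (left_adjoint_Ext1 (opp_adjunction adj)) => [Y Z m|P Pproj].
  exact: Fmono.
by apply/Ext1_eq0_opp/acyc => Y Z e f; apply: Pproj.
Qed.

Lemma left_ff_unit_iso : fully_faithful F ->
  forall X : A, is_iso (unit_adj adj X).
Proof.
move=> Fff X.
have [|d [d1 d2]] := @right_ff_counit_iso _ _ _ _ (opp_adjunction adj) _ X.
  by move=> Y Z g; apply: Fff.
by exists d.
Qed.

End AdjunctionDual.

(** * Vanishing and Ext^1 comparisons in a recollement *)

Section Recollement.
Variables A' A A'' : abelian_category.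
Variable R : recollement A' A A''.

Local Notation i_up := (i_up R).
Local Notation i_low := (i_low R).
Local Notation i_sharp := (i_sharp R).
Local Notation j_shriek := (j_shriek R).
Local Notation j_up := (j_up R).
Local Notation j_low := (j_low R).
Local Notation adj_i := (adj_iup_ilow R).
Local Notation adj_i' := (adj_ilow_isharp R).
Local Notation adj_j := (adj_jshriek_jup R).
Local Notation adj_j' := (adj_jup_jlow R).

Lemma jup_ilow_zero (X : A') : is_zero (j_up (i_low X)).
Proof.
suff : [set Z | is_zero (j_up Z)] (i_low X) by [].
rewrite ker_jup_im_ilow; exists X, (idm _), (idm _).
by rewrite comp1m.
Qed.

Lemma jup_zero_ilow (Z : A) :
  is_zero (j_up Z) -> exists X : A', isomorphic Z (i_low X).
Proof.
move=> Z0; have : [set Z | is_zero (j_up Z)] Z by [].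
by rewrite ker_jup_im_ilow.
Qed.

Lemma hom_jshriek_ilow (X : A'') (Y : A') (f : hom (j_shriek X) (i_low Y)) :
  f = 0.
Proof.
by rewrite -(flatK adj_j f) ((jup_ilow_zero Y).2 _ (flat _ f)) sharp0.
Qed.

Lemma hom_ilow_jlow (X : A') (Y : A'') (f : hom (i_low X) (j_low Y)) : f = 0.
Proof.
by rewrite -(sharpK adj_j' f) ((jup_ilow_zero X).1 _ (sharp _ f)) flat0.
Qed.

Lemma iup_jshriek_zero (X : A'') : is_zero (i_up (j_shriek X)).
Proof.
apply/is_zeroP; rewrite -(flatK adj_i (idm _)).
by rewrite (hom_jshriek_ilow (flat _ _)) sharp0.
Qed.

Lemma isharp_jlow_zero (X : A'') : is_zero (i_sharp (j_low X)).
Proof.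
apply/is_zeroP; rewrite -(sharpK adj_i' (idm _)).
by rewrite (hom_ilow_jlow (sharp _ _)) flat0.
Qed.

Lemma iup_ilow_iso (X : A') : isomorphic (i_up (i_low X)) X.
Proof. by exists (counit_adj adj_i X); apply/right_ff_counit_iso/i_low_ff. Qed.

Lemma isharp_ilow_iso (X : A') : isomorphic X (i_sharp (i_low X)).
Proof. by exists (unit_adj adj_i' X); apply/left_ff_unit_iso/i_low_ff. Qed.

Lemma jup_jshriek_iso (X : A'') : isomorphic X (j_up (j_shriek X)).
Proof. by exists (unit_adj adj_j X); apply/left_ff_unit_iso/j_shriek_ff. Qed.

Lemma jup_jlow_iso (X : A'') : isomorphic (j_up (j_low X)) X.
Proof. by exists (counit_adj adj_j' X); apply/right_ff_counit_iso/j_low_ff. Qed.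

Lemma jup_counit_epi (M : A) : epi (fmap j_up (counit_adj adj_j M)).
Proof.
apply: (@epi_of_comp _ _ _ _ (unit_adj adj_j (j_up M))).
by rewrite triangle_right => Z a b; rewrite !compm1.
Qed.

Lemma jup_unit_mono (M : A) : mono (fmap j_up (unit_adj adj_j' M)).
Proof.
apply: (@mono_of_comp _ _ _ _ _ (counit_adj adj_j' (j_up M))).
by rewrite triangle_left => Z a b; rewrite !comp1m.
Qed.

(** The right adjoint [i_low] is itself a left adjoint, so it preserves epis as the comparison
    requires. The next three lemmas use the adjoint on the other side of [i_low] or [j_up] in the
    same way. *)
Lemma iup_Ext1 (M : A) (X : A') : is_zero (L1 i_up M) ->
  Ext1_eq0 M (i_low X) <-> Ext1_eq0 (i_up M) X.
Proof.
move=> /(L1_zeroP adj_i) acyc; apply: (left_adjoint_Ext1 adj_i) => //.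
exact: left_adjoint_epi adj_i'.
Qed.

Lemma isharp_Ext1 (X : A') (N : A) : is_zero (R1 i_sharp N) ->
  Ext1_eq0 (i_low X) N <-> Ext1_eq0 X (i_sharp N).
Proof.
move=> /(R1_zeroP adj_i') acyc; apply: (right_adjoint_Ext1 adj_i') => //.
exact: right_adjoint_mono adj_i.
Qed.

Lemma jshriek_Ext1 (U : A'') (X : A) : is_zero (L1 j_shriek U) ->
  Ext1_eq0 U (j_up X) <-> Ext1_eq0 (j_shriek U) X.
Proof.
move=> /(L1_zeroP adj_j) acyc; apply: (left_adjoint_Ext1 adj_j) => //.
exact: left_adjoint_epi adj_j'.
Qed.

Lemma jlow_Ext1 (X : A) (V : A'') : is_zero (R1 j_low V) ->
  Ext1_eq0 (j_up X) V <-> Ext1_eq0 X (j_low V).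
Proof.
move=> /(R1_zeroP adj_j') acyc; apply: (right_adjoint_Ext1 adj_j') => //.
exact: right_adjoint_mono adj_j.
Qed.

(* The middle term of an extension of objects of [Im i_low = Ker j_up] lies in
   [Ker j_up], so the extension comes from [A']. *)
Lemma ilow_Ext1 (X Y : A') : Ext1_eq0 X Y -> Ext1_eq0 (i_low X) (i_low Y).
Proof.
move=> /Ext1_eq0P XY; apply/Ext1_eq0P => E a b [ak bc].
have [|E' [u [v [vu uv]]]] := @jup_zero_ilow E.
  apply: is_zeroP.
  have [|h <-] := cokernel_desc (g := idm _) (left_adjoint_cokernel adj_j' bc).
    by rewrite comp1m; apply: (jup_ilow_zero Y).1.
  by rewrite ((jup_ilow_zero X).1 _ h) comp0m.
have [a' [a'E _]] := i_low_ff (u ∘ a).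
have [b' [b'E _]] := i_low_ff (b ∘ v).
have [|s sE] := XY _ a' b'.
  (* It suffices to transport exactness along the isomorphism of [E] with [i_low E']. *)
  apply: (ff_reflect_short_exact (@i_low_ff _ _ _ R)); rewrite a'E b'E; split.
    apply: is_kernelI.
    - move=> Z g h e; apply: (kernel_mono ak).
      by rewrite -[LHS]comp1m -vu -compA (compA u) e !compA vu comp1m.
    - by rewrite -compA (compA v) vu comp1m ak.1.
    move=> Z g; rewrite -compA => /(kernel_lift ak) [h hE]; exists h.
    by rewrite -compA hE compA uv comp1m.
  apply: is_cokernelI.
  - move=> Z g h e; apply: (cokernel_epi bc).
    by rewrite -[LHS]compm1 -vu compA -(compA g) e -!compA vu compm1.
  - by rewrite -compA (compA v) vu comp1m ak.1.
  move=> Z g; rewrite compA => /(cokernel_desc bc) [h hE]; exists h.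
  by rewrite compA hE -compA uv compm1.
by exists (v ∘ fmap i_low s); rewrite compA -b'E -fmap_comp sE fmap1.
Qed.

(** * Consequences of condition (P): units at injectives and counits on [M] *)

Section ConditionP.
Hypothesis hP : condition_P R.

(** A projective cover map [u] of [j_low (j_up I)] is shown to factor through the unit. *)
Lemma unit_injective_epi (I : A) :
  injective_object I -> epi (unit_adj adj_j' I).
Proof.
move=> Iinj; set P := proj (j_low (j_up I)); pose u : hom P _ := proj_epi _.
have Pproj : projective P by apply: projP.
pose v := sharp adj_j' u.
(* Condition (P) makes the counit at [P] mono, so the transpose of [v] under the other adjunction
   extends to [w] on [P]. *)
have [w wE] := Iinj _ _ _ (counit_adj adj_j I ∘ fmap j_shriek v) (hP Pproj).
have jw : fmap j_up w = v.
  have := congr1 (fun g => flat adj_j g) wE; rewrite counit_nat.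
  by rewrite !flat_compr /flat triangle_right !comp1m.
suff uE : unit_adj adj_j' I ∘ w = u.
  apply: (@epi_of_comp _ _ _ _ w); rewrite uE; exact: proj_epiP.
by rewrite -unit_nat jw -[RHS](sharpK adj_j').
Qed.

(* The adjunct of [f] under both adjunctions is a map [M -> j_low (j_up I)];
   it lifts to [I] because the kernel of [I -> j_low (j_up I)] is [i_low] of
   an injective object. *)
Lemma extend_along_counit (M I : A) (f : hom (j_shriek (j_up M)) I) :
  is_zero (L1 i_up M) -> injective_object I ->
  exists g : hom M I, g ∘ counit_adj adj_j M = f.
Proof.
move=> /(L1_zeroP adj_i) acyc Iinj.
have se := short_exact_ker (unit_injective_epi Iinj).
have [|Y [a [b [ba ab]]]] := @jup_zero_ilow (ker (unit_adj adj_j' I)).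
  apply/is_zeroP/(mono_eq0 (right_adjoint_mono adj_j (kernel_mono se.1))).
  rewrite compm1; apply: (mono_eq0 (@jup_unit_mono I)).
  by rewrite -fmap_comp se.1.1 fmap0.
(* An extension to [I] of a map from [i_low S] lands in the kernel of the unit, since no nonzero map
   goes from [Im i_low] to [Im j_low]. *)
have Yinj : injective_object Y.
  move=> S T m h mm.
  have [g gE] := Iinj _ _ _ (ker_in _ ∘ b ∘ fmap i_low h)
    (right_adjoint_mono adj_i mm).
  have [|g' g'E] := kernel_lift (g := g) se.1; first exact: hom_ilow_jlow.
  have [k [kE _]] := i_low_ff (a ∘ g').
  exists k; apply: (ff_faithful (@i_low_ff _ _ _ R)); rewrite fmap_comp kE.
  have : g' ∘ fmap i_low m = b ∘ fmap i_low h.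
    by apply: (kernel_mono se.1); rewrite !compA g'E gE.
  by rewrite -compA => ->; rewrite compA ab comp1m.
have ext0 : Ext1_eq0 M (ker (unit_adj adj_j' I)).
  by apply: Ext1_eq0_isor (acyc _ Yinj); exists b, a.
have /(Ext1_eq0_injective _ Iinj se) lift := ext0.
have [g gE] := lift (flat adj_j' (flat adj_j f)).
exists g; apply: (flat_inj (adj := adj_j)).
rewrite flat_compl /flat triangle_right compm1.
rewrite -[RHS](flatK adj_j' (flat adj_j f)) -gE -unit_nat.
by rewrite -[RHS]/(sharp _ (flat _ _)) flatK.
Qed.

Lemma counit_mono (M : A) :
  is_zero (L1 i_up M) -> mono (counit_adj adj_j M).
Proof.
move=> M0; have [g gE] := extend_along_counit (inj_mono _) M0 (@injP _ _).
by apply: (@mono_of_comp _ _ _ _ _ g); rewrite gE; apply: inj_monoP.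
Qed.

(** The cokernel of the counit is killed by [j_up], so it lies in [Im i_low]. Both it and
    [i_low (i_up M)] are universal for maps from [M] to [Im i_low], as these all kill the counit. *)
Lemma M_short_exact (M : A) : is_zero (L1 i_up M) ->
  exists (C : A) (c : hom M C),
    short_exact (counit_adj adj_j M) c /\ isomorphic (i_low (i_up M)) C.
Proof.
move=> M0; have em := counit_mono M0.
have se := short_exact_coker em.
set c := coker_pr _ in se.
exists (coker (counit_adj adj_j M)), c; split=> //.
have [|Y [a [b [ba ab]]]] := @jup_zero_ilow (coker (counit_adj adj_j M)).
  have ce := left_adjoint_cokernel adj_j' se.2.
  apply/is_zeroP/(epi_eq0 (cokernel_epi ce)).
  by rewrite comp1m; apply: (epi_eq0 (@jup_counit_epi M)); apply: ce.1.
have [|d dE] := cokernel_desc (g := unit_adj adj_i M) se.2.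
  exact: hom_jshriek_ilow.
(* [a ∘ c] factors through the unit of [(i_up, i_low)]. *)
pose c' := sharp adj_i (a ∘ c).
have c'E : fmap i_low c' ∘ unit_adj adj_i M = a ∘ c.
  exact: (sharpK adj_i (a ∘ c)).
exists (b ∘ fmap i_low c'), d; split.
  have [e [eE _]] := i_low_ff (d ∘ (b ∘ fmap i_low c')).
  rewrite -eE; suff -> : e = idm _ by rewrite fmap1.
  apply: (flat_inj (adj := adj_i)); rewrite /flat eE fmap1 comp1m.
  by rewrite -!compA c'E (compA b) ba comp1m.
apply: (cokernel_epi se.2).
by rewrite -compA dE -compA c'E compA ba.
Qed.

End ConditionP.

(** * Test objects, orthogonality and the two inclusions *)

Section CotorsionPairs.
Variables (U' V' : set A') (U'' V'' : set A'').
Hypothesis hUV' : cotorsion_pair U' V'.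
Hypothesis hUV'' : cotorsion_pair U'' V''.
Hypothesis hL : forall U : A'', U'' U -> is_zero (L1 j_shriek U).
Hypothesis hR : forall V : A'', V'' V -> is_zero (R1 j_low V).

Lemma cotorsionE (B : abelian_category) (C D : set B) :
  cotorsion_pair C D ->
  (forall X, D X <-> forall Y, C Y -> Ext1_eq0 Y X) /\
  (forall X, C X <-> forall Y, D Y -> Ext1_eq0 X Y).
Proof.
move=> [CD DC]; split=> X; first by rewrite -[in D X]CD.
by rewrite -[in C X]DC.
Qed.

Let V'E := (cotorsionE hUV').1.
Let U'E := (cotorsionE hUV').2.
Let V''E := (cotorsionE hUV'').1.
Let U''E := (cotorsionE hUV'').2.

Lemma M_ilow (X : A') : U' X -> M_class R U' U'' (i_low X).
Proof.
move=> XU; split.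
- apply/U'E => Y YV; apply: Ext1_eq0_isol (isomorphic_sym (iup_ilow_iso X)) _.
  exact: (U'E X).1.
- by apply/U''E => Y _; apply/Ext1_eq0_zerol/jup_ilow_zero.
- by apply/(L1_zeroP adj_i) => I Iinj; apply/ilow_Ext1/injective_Ext1_eq0.
Qed.

(** For the derived condition, Ext^1 from [j_shriek U] to [i_low I] is moved to Ext^1 from [U] to
    the zero object [j_up (i_low I)]. *)
Lemma M_jshriek (U : A'') : U'' U -> M_class R U' U'' (j_shriek U).
Proof.
move=> UU; split.
- by apply/U'E => Y _; apply/Ext1_eq0_zerol/iup_jshriek_zero.
- apply/U''E => Y YV; apply: Ext1_eq0_isol (jup_jshriek_iso U) _.
  exact: (U''E U).1.
- apply/(L1_zeroP adj_i) => I _; apply/(jshriek_Ext1 _ (hL UU)).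
  exact/Ext1_eq0_zeror/jup_ilow_zero.
Qed.

Lemma N_ilow (X : A') : V' X -> N_class R V' V'' (i_low X).
Proof.
move=> XV; split.
- apply/V'E => Y YU; apply: Ext1_eq0_isor (isharp_ilow_iso X) _.
  exact: (V'E X).1.
- by apply/V''E => Y _; apply/Ext1_eq0_zeror/jup_ilow_zero.
- by apply/(R1_zeroP adj_i') => P Pproj; apply/ilow_Ext1/projective_Ext1_eq0.
Qed.

Lemma N_jlow (V : A'') : V'' V -> N_class R V' V'' (j_low V).
Proof.
move=> VV; split.
- by apply/V'E => Y _; apply/Ext1_eq0_zeror/isharp_jlow_zero.
- apply/V''E => Y YU; apply: Ext1_eq0_isor (isomorphic_sym (jup_jlow_iso V)) _.
  exact: (V''E V).1.
- apply/(R1_zeroP adj_i') => P _; apply/(jlow_Ext1 _ (hR VV)).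
  exact/Ext1_eq0_zerol/jup_ilow_zero.
Qed.

Lemma Ext1_M_N (hP : condition_P R) (M N : A) :
  M_class R U' U'' M -> N_class R V' V'' N -> Ext1_eq0 M N.
Proof.
move=> [M' M'' M0] [N' N'' N0].
have [C [c [se CE]]] := M_short_exact hP M0.
apply: (Ext1_eq0_extension se).
  by apply/(jshriek_Ext1 _ (hL M'')); apply: (U''E _).1.
apply: (Ext1_eq0_isol CE); apply/(isharp_Ext1 _ N0).
exact: (U'E _).1.
Qed.

(** The derived condition comes first, tested on projectives of [A'], which lie in [U']; it then
    permits moving Ext^1 across the adjunction of [i_low] and [i_sharp]. *)
Lemma rperp_M_sub_N : rperp (M_class R U' U'') `<=` N_class R V' V''.
Proof.
move=> X XM.
have X0 : is_zero (R1 i_sharp X).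
  apply/(R1_zeroP adj_i') => P Pproj; apply/XM/M_ilow/U'E => Y _.
  exact: projective_Ext1_eq0.
split=> //.
- by apply/V'E => Y YU; apply/(isharp_Ext1 _ X0)/XM/M_ilow.
- by apply/V''E => Y YU; apply/(jshriek_Ext1 _ (hL YU))/XM/M_jshriek.
Qed.

(** Dually, injectives of [A'] lie in [V'] and give the derived condition for [i_up]. *)
Lemma lperp_N_sub_M : lperp (N_class R V' V'') `<=` M_class R U' U''.
Proof.
move=> X XN.
have X0 : is_zero (L1 i_up X).
  apply/(L1_zeroP adj_i) => I Iinj; apply/XN/N_ilow/V'E => Y _.
  exact: injective_Ext1_eq0.
split=> //.
- by apply/U'E => Y YV; apply/(iup_Ext1 _ X0)/XN/N_ilow.
- by apply/U''E => Y YV; apply/(jlow_Ext1 _ (hR YV))/XN/N_jlow.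
Qed.

End CotorsionPairs.

End Recollement.

Theorem proposition3p7 (A' A A'' : abelian_category)
    (R : recollement A' A A'') (hP : condition_P R)
    (U' V' : set A') (U'' V'' : set A'')
    (hUV' : cotorsion_pair U' V') (hUV'' : cotorsion_pair U'' V'')
    (hL : forall U : A'', U'' U -> is_zero (L1 (j_shriek R) U))
    (hR : forall V : A'', V'' V -> is_zero (R1 (j_low R) V)) :
  (lperp (N_class R V' V''), N_class R V' V'') =
  (M_class R U' U'', rperp (M_class R U' U'')).
Proof.
have MN := Ext1_M_N hUV' hUV'' hL hP.
congr pair; apply/seteqP; split=> X.
- exact: lperp_N_sub_M.
- by move=> XM Y YN; apply: MN.
- by move=> XN Y YM; apply: MN.
- exact: rperp_M_sub_N.
Qed.
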